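(* Let $M$ be a monoid, let $G_L$, $G_R$ and $G$ be its sets of left units, right units and (two-sided) units, let $E=\langle E(M)\rangle$ be the subsemigroup generated by the set $E(M)$ of all idempotents of $M$, and let $F=\langle E(M)\cup G\rangle$. Suppose that $G_L=G$ (or, equivalently, that $G_R=G$). Then: (i) if $M=\langle U\rangle$, then $G=\langle G\cap U\rangle$; (ii) if $G\neq\{1\}$, then for $U\subseteq M$ we have $M=\langle E\cup U\rangle$ if and only if the sets $U_1=G\cap U$ and $U_2=U\setminus G$ satisfy $G=\langle U_1\rangle$ and $M=\langle F\cup U_2\rangle$; (iii) if $G\neq\{1\}$, then $\operatorname{rank}(M:E)=\operatorname{rank}(G)+\operatorname{rank}(M:F)$.
   Context: An element $x$ of a monoid $M$ is a left unit if $ax=1$ for some $a\in M$, a right unit if $xb=1$ for some $b\in M$, and a (two-sided) unit if it is both a left unit and a right unit. For a subset $U$ of a semigroup $S$, $\langle U\rangle$ denotes the subsemigroup of $S$ generated by $U$. The rank of $S$ is $\operatorname{rank}(S)=\min\{|U| : U\subseteq S,\ S=\langle U\rangle\}$ (generation as a semigroup), and for $A\subseteq S$ the relative rank of $S$ modulo $A$ is $\operatorname{rank}(S:A)=\min\{|U| : U\subseteq S,\ S=\langle A\cup U\rangle\}$. These are (possibly infinite) cardinals. *)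

(* Defs.v *)
From mathcomp Require Import all_boot boolp classical_sets functions cardinality.

Set Implicit Arguments.
Unset Strict Implicit.
Unset Printing Implicit Defensive.

Local Open Scope classical_set_scope.
Local Open Scope card_scope.
Local Open Scope group_scope.

(* A cardinal is represented by a set having that cardinality: equality of
   cardinals is [#=], their order is [#<=], and the sum of the cardinals of [A]
   and [B] is that of [[set: A + B]], where [A] and [B] are coerced to types.
   [least_card P] is a member of [P] of least cardinality, so it stands for
   min {|U| : U in P}; see [least_cardP] below. *)
Definition least_card (T : Type) (P : set (set T)) : set T :=
  get [set U | P U /\ forall V, P V -> U #<= V].

(* Well-foundedness of cardinals. Zorn's lemma gives a maximal set of choice
   functions on [P] that is separated by each single evaluation at a member of
   [P]; by maximality, one of these evaluations is onto that member. *)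
Lemma least_card_ex (T : Type) (P : set (set T)) :
  P !=set0 -> exists2 U, P U & forall V, P V -> U #<= V.
Proof.
move=> [U0 PU0].
pose good (S : set (set T -> T)) := forall U, P U ->
  (forall f, S f -> U (f U)) /\ (forall f g, S f -> S g -> f U = g U -> f = g).
have [F Fgood totF|S [Sgood Smax]] := @Zorn_bigcup _ good.
  move=> U PU; split=> [f [A FA Af]|f g [A FA Af] [B FB Bg]].
    by have [+ _] := Fgood _ FA _ PU; apply.
  have [_ injA] := Fgood _ FA _ PU; have [_ injB] := Fgood _ FB _ PU.
  by have [AB|BA] := totF _ _ FA FB; [apply: injB => //; apply: AB|
                                      apply: injA => //; apply: BA].
have [[U PU surjU]|nsurj] :=
    pselect (exists2 U, P U & forall x, U x -> exists2 f, S f & f U = x).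
  exists U => // V PV; have [SU _] := Sgood _ PU; have [SV injV] := Sgood _ PV.
  apply: (@card_le_trans _ _ _ S).
    have -> : U = (fun f => f U) @` S.
      by apply/seteqP; split=> [x /surjU [f Sf <-]|_ [f /SU ? <-] //]; exists f.
    exact: card_image_le.
  have imS : (fun f => f V) @` S #= S.
    by apply: inj_card_eq => f g /set_mem Sf /set_mem Sg; exact: injV.
  rewrite -(card_le_eql imS).
  by apply: subset_card_le => _ [f /SV Vf <-].
have new U : P U -> exists2 x, U x & forall g, S g -> g U <> x.
  move=> PU; apply: contrapT => nx; apply: nsurj; exists U => // x Ux.
  apply: contrapT => nf; apply: nx; exists x => // g Sg gU.
  by apply: nf; exists g.
have [x0 _ _] := new _ PU0.
have /choice[f fP] U : exists x, P U -> U x /\ forall g, S g -> g U <> x.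
  have [/new[x Ux xS]|nPU] := pselect (P U); first by exists x.
  by exists x0.
exfalso; apply: (Smax (S `|` [set f])).
  split; first by move=> g Sg; left.
  by move=> /(_ f (or_intror erefl)) Sf; apply: ((fP _ PU0).2 _ Sf).
move=> U PU; have [fU fS] := fP _ PU; have [SU injU] := Sgood _ PU.
split=> [g [/SU|->]//|g h [Sg|->] [Sh|->] //]; first exact: injU.
  by move=> /(fS _ Sg).
by move=> /esym /(fS _ Sh).
Qed.

Lemma least_cardP (T : Type) (P : set (set T)) : P !=set0 ->
  P (least_card P) /\ forall V, P V -> least_card P #<= V.
Proof.
move=> /least_card_ex [U PU Umin].
exact: (@getI _ [set U | P U /\ forall V, P V -> U #<= V] U).
Qed.

Definition gen (S : semigroupType) (U : set S) : set S :=
  smallest [set A : set S | forall x y, A x -> A y -> A (x * y)] U.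

Lemma gen_id (S : semigroupType) (A : set S) :
  (forall x y, A x -> A y -> A (x * y)) -> gen A = A.
Proof. exact: smallest_id. Qed.

(* Ranks of a subsemigroup [A] of [S]. *)
Definition rank (S : semigroupType) (A : set S) : set S :=
  least_card [set U | U `<=` A /\ A = gen U].

Definition relrank (S : semigroupType) (A B : set S) : set S :=
  least_card [set U | U `<=` A /\ A = gen (B `|` U)].

Lemma rankP (S : semigroupType) (A : set S) :
  (forall x y, A x -> A y -> A (x * y)) ->
  [/\ rank A `<=` A, A = gen (rank A)
    & forall V, V `<=` A -> A = gen V -> rank A #<= V].
Proof.
move=> Amul.
have [|[rA gA] min] := @least_cardP _ [set U | U `<=` A /\ A = gen U].
  by exists A; split=> //; rewrite gen_id.
by split=> // V VA AV; apply: min.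
Qed.

Lemma relrankP (S : semigroupType) (A B : set S) :
  (forall x y, A x -> A y -> A (x * y)) -> B `<=` A ->
  [/\ relrank A B `<=` A, A = gen (B `|` relrank A B)
    & forall V, V `<=` A -> A = gen (B `|` V) -> relrank A B #<= V].
Proof.
move=> Amul BA.
have [|[rA gA] min] := @least_cardP _ [set U | U `<=` A /\ A = gen (B `|` U)].
  by exists A; split=> //; rewrite (iffRL (setUidPr _ _) BA) gen_id.
by split=> // V VA AV; apply: min.
Qed.

Section Monoid.
Variable M : monoidType.

Definition left_units : set M := [set x | exists a, a * x = 1].

Definition right_units : set M := [set x | exists b, x * b = 1].

Definition units : set M := left_units `&` right_units.

Definition idempotents : set M := [set e | e * e = e].

End Monoid.

Arguments left_units M : clear implicits.
Arguments right_units M : clear implicits.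
Arguments units M : clear implicits.
Arguments idempotents M : clear implicits.

(* Main.v *)
Require Import Defs.
From mathcomp Require Import all_boot boolp classical_sets functions cardinality.

Set Implicit Arguments.
Unset Strict Implicit.
Unset Printing Implicit Defensive.

Local Open Scope classical_set_scope.
Local Open Scope card_scope.
Local Open Scope group_scope.

(** Once every one-sided unit is two-sided, a product [x * y] is a unit only
    when both [x] and [y] are ([units_factors]): the nonunits form an ideal. So
    a product of generators that is a unit uses only generators that are units,
    and whatever generates [M] generates the group [G] of units by its members
    lying in [G] ([units_gen]). This is (i).

    For (ii), apply this to the idempotents together with [U]. The only
    idempotent unit is [1], so [G] is generated by [1] and [G `&` U]; and when
    [G] is nontrivial, [1] is redundant, being [g * h] for some [g <> 1] in [G]
    with inverse [h <> 1] ([gen_nontrivial]). The condition on [U `\` G]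
    then merely trades the part [G `&` U] of [U] for [G], which it generates.

    By (ii), a generating set of [M] modulo [E] is the disjoint union of a
    generating set of [G] and a generating set of [M] modulo [F] consisting of
    nonunits; restricting to nonunits loses nothing, since [F] contains [G].
    Minimising both parts independently gives (iii): the two inequalities of
    cardinals follow from [relrank_units_ge] and [relrank_units_le], and are
    combined by the Cantor-Bernstein theorem. *)

(** * Generation *)

Lemma gen_mul {S : semigroupType} (U : set S) x y :
  gen U x -> gen U y -> gen U (x * y).
Proof.
by move=> Ux Uy A CA; have [Amul _] := CA; apply: Amul; [exact: Ux|exact: Uy].
Qed.

Lemma sub_gen {S : semigroupType} (U : set S) : U `<=` gen U.
Proof. exact: sub_gen_smallest. Qed.

Lemma gen_sub {S : semigroupType} (U A : set S) :
  (forall x y, A x -> A y -> A (x * y)) -> U `<=` A -> gen U `<=` A.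
Proof. by move=> Amul UA; apply: smallest_sub. Qed.

Lemma gen_subgen {S : semigroupType} (U V : set S) :
  U `<=` gen V -> gen U `<=` gen V.
Proof. by apply: gen_sub => x y; exact: gen_mul. Qed.

Lemma genS {S : semigroupType} (U V : set S) : U `<=` V -> gen U `<=` gen V.
Proof. by move=> UV; apply: gen_subgen => x /UV; exact: sub_gen. Qed.

Lemma gen_setT_sub {S : semigroupType} (U V : set S) :
  [set: S] = gen U -> U `<=` gen V -> [set: S] = gen V.
Proof.
move=> gU UV; apply/seteqP; split=> // x _.
by apply: (gen_subgen UV); rewrite -gU.
Qed.

Lemma gen_genU {S : semigroupType} (A B : set S) :
  gen (gen A `|` B) = gen (A `|` B).
Proof.
apply/seteqP; split; last by apply: genS => x [/sub_gen|]; [left|right].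
apply: gen_subgen => x [|Bx]; last by apply: sub_gen; right.
by apply: genS => y; left.
Qed.

(** When the complement of [H] is an ideal, a product lying in [H] has all its
    factors in [H]. *)
Lemma gen_setI {S : semigroupType} (H U : set S) :
  (forall x y, H x -> H y -> H (x * y)) ->
  (forall x y, H (x * y) -> H x /\ H y) ->
  H `&` gen U = gen (H `&` U).
Proof.
move=> Hmul Hfac; apply/seteqP; split=> [x [Hx Ux]|]; last first.
  apply: gen_sub => [x y [Hx Ux] [Hy Uy]|x [Hx Ux]]; last first.
    by split=> //; exact: sub_gen.
  by split; [exact: Hmul|exact: gen_mul].
have: gen U `<=` [set y | H y -> gen (H `&` U) y].
  apply: gen_sub => [y z /= Vy Vz /Hfac[Hy Hz]|y Uy Hy].
    by apply: gen_mul; [exact: Vy|exact: Vz].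
  exact: sub_gen.
by apply.
Qed.

(** * Units *)

Lemma units1 (M : monoidType) : units M 1.
Proof. by split; exists 1; rewrite mulg1. Qed.

Lemma units_mul (M : monoidType) (x y : M) :
  units M x -> units M y -> units M (x * y).
Proof.
move=> [[a ax] [b xb]] [[c cy] [d yd]]; split.
  by exists (c * a); rewrite -mulgA (mulgA a) ax mul1g.
by exists (d * b); rewrite -mulgA (mulgA y) yd mul1g.
Qed.

Lemma units_inv (M : monoidType) (x : M) :
  units M x -> exists2 y, units M y & x * y = 1.
Proof.
move=> [[a ax] [b xb]]; exists b => //; split; last first.
  (* the left and the right inverse of [x] coincide *)
  by exists x; rewrite -[b]mul1g -ax -(mulgA a) xb mulg1.
by exists x.
Qed.

(** If [a * x = 1] then [x] is a left unit and [a] a right unit, so that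
    either class being two-sided makes the other so. *)
Lemma left_right_units (M : monoidType) :
  left_units M = units M <-> right_units M = units M.
Proof.
have inv (x y z : M) : x * y = 1 -> y * z = 1 -> x = z.
  by move=> xy yz; rewrite -[x]mulg1 -yz mulgA xy mul1g.
split=> eqG; apply/seteqP; split=> [x|x []//].
  move=> [b xb]; have [_ [c bc]] : units M b by rewrite -eqG; exists x.
  by split; [exists b; rewrite (inv _ _ _ xb bc)|exists b].
move=> [a ax]; have [[c ca] _] : units M a by rewrite -eqG; exists x.
by split; [exists a|exists a; rewrite -(inv _ _ _ ca ax)].
Qed.

(** A left inverse of [x * y] makes [y] a left unit, and a right inverse makes
    [x] a right unit; these are two-sided by hypothesis. *)
Lemma units_factors (M : monoidType) : left_units M = units M ->
  forall x y : M, units M (x * y) -> units M x /\ units M y.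
Proof.
move=> GL x y [[a axy] [b xyb]]; split.
  by rewrite -(iffLR (left_right_units M) GL); exists (y * b); rewrite mulgA.
by rewrite -GL; exists (a * x); rewrite -mulgA.
Qed.

Lemma units_gen (M : monoidType) (U : set M) : left_units M = units M ->
  [set: M] = gen U -> units M = gen (units M `&` U).
Proof.
move=> GL gU; rewrite -gen_setI -?gU ?setIT //; first exact: units_mul.
exact: units_factors.
Qed.

Lemma units_idempotents (M : monoidType) :
  units M `&` idempotents M `<=` [set 1].
Proof. by move=> e [[[a ae] _] ee]; rewrite /= -ae -{2}ee mulgA ae mul1g. Qed.

(** Adjoining [1] to [V] adds at most [1] to what [V] generates, and a
    nontrivial unit in [gen V] yields [1] there together with its inverse. *)
Lemma gen_nontrivial (M : monoidType) (V : set M) :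
  units M <> [set 1] -> V `<=` units M ->
  units M `<=` gen ([set 1] `|` V) -> units M = gen V.
Proof.
move=> ntG VG GV; apply/seteqP; split; last first.
  by apply: gen_sub => //; exact: units_mul.
have G1V : units M `<=` [set 1] `|` gen V.
  apply: (subset_trans GV); apply: gen_sub => [x y|x [|/sub_gen]];
    try by [left|right].
  move=> [->|Vx] [->|Vy]; rewrite ?mulg1 ?mul1g; [left|right|right|right] => //.
  exact: gen_mul.
have [g Gg g1] : exists2 g, units M g & g <> 1.
  apply: contrapT => triv; apply: ntG; apply/seteqP; split=> [g Gg|_ ->].
    by apply: contrapT => g1; apply: triv; exists g.
  exact: units1.
have [h Gh gh] := units_inv Gg.
have h1 : h <> 1 by move=> h1; apply: g1; rewrite -gh h1 mulg1.
have [//|Vg] := G1V _ Gg; have [//|Vh] := G1V _ Gh.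
by move=> x /G1V[->|//]; rewrite -gh; exact: gen_mul.
Qed.

(** A unit never arises from nonunits, so the units of [U] have to generate all
    units by themselves; conversely, once they do, they supply the generators
    [G] of [F] that are missing from [E]. *)
Lemma gen_idempotents_units (M : monoidType) (U : set M) :
  left_units M = units M -> units M <> [set 1] ->
  [set: M] = gen (gen (idempotents M) `|` U) <->
  units M = gen (units M `&` U) /\
    [set: M] = gen (gen (idempotents M `|` units M) `|` (U `\` units M)).
Proof.
move=> GL ntG; rewrite !gen_genU; split=> [gU|[gG gU]]; last first.
  apply: (gen_setT_sub gU) => x [[Ex|]|[Ux _]].
  - by apply: sub_gen; left.
  - by rewrite gG; apply: genS => y [_ Uy]; right.
  - by apply: sub_gen; right.
split; last first.
  apply: (gen_setT_sub gU) => x [Ex|Ux]; apply: sub_gen; first by left; left.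
  by have [Gx|nGx] := pselect (units M x); [left; right|right].
apply: gen_nontrivial => //.
rewrite {1}(units_gen GL gU); apply: genS => x [Gx [Ex|Ux]]; last by right.
by left; apply: units_idempotents.
Qed.

(** * Ranks *)

Lemma card_setU_le {T : Type} (A B : set T) : A `|` B #<= [set: (A + B)%type].
Proof.
pose f (u : (A + B)%type) := match u with inl a => val a | inr b => val b end.
apply: (card_le_trans _ (card_image_le f _)).
apply: subset_card_le => x [Ax|Bx].
  by exists (inl (SigSub (mem_set Ax))).
by exists (inr (SigSub (mem_set Bx))).
Qed.

Lemma card_sum_le {T1 T2 T : Type} (A : set T1) (B : set T2) (U V : set T) :
  U `&` V = set0 -> A #<= U -> B #<= V -> [set: (A + B)%type] #<= U `|` V.
Proof.
move=> UV0 /card_leP[f] /card_leP[g].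
pose h (u : (A + B)%type) :=
    match u with inl a => val (f a) | inr b => val (g b) end.
have fg a b : val (f a) <> val (g b).
  move=> e; have : (U `&` V) (val (f a)).
    by split; [|rewrite e]; exact/set_mem/valP.
  by rewrite UV0.
have hinj : {in [set: (A + B)%type] &, injective h}.
  move=> [a|b] [a'|b'] _ _ /= e.
  - by congr inl; apply: (@inj _ _ _ f); rewrite ?in_setT //; exact: val_inj.
  - by case: (fg a b').
  - by case: (fg a' b).
  - by congr inr; apply: (@inj _ _ _ g); rewrite ?in_setT //; exact: val_inj.
rewrite -(card_le_eql (inj_card_eq hinj)); apply: subset_card_le.
by move=> _ [[a|b] _ <-]; [left|right]; exact/set_mem/valP.
Qed.

(** The units and the nonunits of a least generating set modulo [E] compete
    with the least sets on the left-hand side. *)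
Lemma relrank_units_ge (M : monoidType) :
  left_units M = units M -> units M <> [set 1] ->
  [set: (rank (units M) +
         relrank [set: M] (gen (idempotents M `|` units M)))%type]
    #<= relrank [set: M] (gen (idempotents M)).
Proof.
move=> GL ntG.
have [//|//|_ gR _] := @relrankP M [set: M] (gen (idempotents M)).
have [gG gF] := iffLR (gen_idempotents_units _ GL ntG) gR.
have [_ _ minG] := rankP (@units_mul M).
have [//|//|_ _ minF] :=
  @relrankP M [set: M] (gen (idempotents M `|` units M)).
rewrite -[X in _ #<= X](setUIDK _ (units M)) [_ `&` units M]setIC.
apply: card_sum_le; [|apply: minG|apply: minF] => //.
by apply/seteqP; split=> // x [[Gx _] [_]].
Qed.

(** Least sets for [G] and for [M] modulo [F] assemble into a generating set
    modulo [E]. Once the units are removed from the second, the two sets are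
    precisely the units and the nonunits of their union. *)
Lemma relrank_units_le (M : monoidType) :
  left_units M = units M -> units M <> [set 1] ->
  relrank [set: M] (gen (idempotents M)) #<=
  [set: (rank (units M) +
         relrank [set: M] (gen (idempotents M `|` units M)))%type].
Proof.
move=> GL ntG.
set F := gen (idempotents M `|` units M).
have [VG gG _] := rankP (@units_mul M).
have [//|//|_ gF _] := @relrankP M [set: M] F.
have [//|//|_ _ minE] := @relrankP M [set: M] (gen (idempotents M)).
set V := rank (units M) in VG gG *; set W := relrank [set: M] F in gF *.
have VWG : units M `&` (V `|` (W `\` units M)) = V.
  by apply/seteqP; split=> [x [Gx [|[_]]]//|x Vx]; split; [exact: VG|left].
have VWD : (V `|` (W `\` units M)) `\` units M = W `\` units M.
  by apply/seteqP; split=> [x [[/VG|]]//|x [Wx nGx]]; split=> //; right.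
apply: (@card_le_trans _ _ _ (V `|` (W `\` units M))).
  apply: minE => //; apply/(gen_idempotents_units _ GL ntG).
  rewrite VWG VWD; split=> //; apply: (gen_setT_sub gF) => x [Fx|Wx].
    by apply: sub_gen; left.
  (* the units discarded from [W] already lie in [F] *)
  apply: sub_gen; have [Gx|nGx] := pselect (units M x); last by right.
  by left; apply: sub_gen; right.
apply: (card_le_trans _ (card_setU_le V W)).
by apply: subset_card_le => x [Vx|[Wx _]]; [left|right].
Qed.

Theorem lemma2p14 (M : monoidType) :
  let G := units M in
  let E := gen (idempotents M) in
  let F := gen (idempotents M `|` G) in
  (left_units M = G <-> right_units M = G) /\
  (left_units M = G ->
    [/\ forall U : set M, [set: M] = gen U -> G = gen (G `&` U),
        G <> [set 1] -> forall U : set M,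
          [set: M] = gen (E `|` U) <->
          G = gen (G `&` U) /\ [set: M] = gen (F `|` (U `\` G))
      & G <> [set 1] ->
          relrank [set: M] E #= [set: (rank G + relrank [set: M] F)%type]]).
Proof.
split; first exact: left_right_units.
move=> GL; split=> [U|ntG U|ntG]; first exact: units_gen.
  exact: gen_idempotents_units.
rewrite card_eq_le; apply/andP; split.
  exact: relrank_units_le.
exact: relrank_units_ge.
Qed.
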